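(* Let $m\ge 2$ and $n\ge 1$ be integers, let $(Y,+)$ be an $(n!)$-divisible Abelian group, and let $X$ be the additive semigroup $(\mathbb{R},+)$ if $m$ is odd and $([0,\infty),+)$ if $m$ is even. Let $f:\mathbb{R}\to Y$ be a function. Then $f$ satisfies $$\sum_{i=0}^{n}(-1)^{n-i}\binom{n}{i} f\left(\sqrt[m]{u^{m}+iv^{m}}\right)=(n!)\,f(v)\quad\text{for all }u,v\in\mathbb{R}$$ if and only if there exists an $n$-monomial $\rho\in\mathcal{M}_n(X,Y)$ such that $$f(u)=\rho(u^{m})\quad\text{for all }u\in\mathbb{R}.$$
   Context: An Abelian group $(Y,+)$ is called $(n!)$-divisible if the homomorphism $Y\to Y$, $y\mapsto (n!)y$, is an isomorphism (so it is bijective). For a commutative semigroup $(X,+)$, a nonnegative integer $j$, $y\in X$ and $\rho:X\to Y$, put $\Delta_y^{j}\rho(x):=\sum_{i=0}^{j}(-1)^{j-i}\binom{j}{i}\rho(x+iy)$ for $x\in X$ (the term $i=0$ is $\rho(x)$ up to sign). The set $\mathcal{M}_j(X,Y)$ of $j$-monomials consists of all functions $\rho:X\to Y$ with $\Delta_y^{j}\rho(x)=(j!)\rho(y)$ for all $x,y\in X$. Here $\sqrt[m]{\cdot}$ is the real $m$-th root: for odd $m$ it is the inverse of $t\mapsto t^m$ on $\mathbb{R}$; for even $m$ it is the nonnegative root of a nonnegative number. *)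

(* Defs.v *)
From HB Require Import structures.
From mathcomp Require Import all_boot all_order all_algebra.
From mathcomp Require Import all_classical all_reals all_analysis.

Set Implicit Arguments.
Unset Strict Implicit.
Unset Printing Implicit Defensive.

Import Order.TTheory GRing.Theory Num.Theory.
Local Open Scope ring_scope.

Section Monomials.
Variables (X : addSemigroupType) (Y : zmodType).

(* [x + i y]: a semigroup need not have a zero, hence no [y *+ i] when [i = 0] *)
Definition add_times (x y : X) (i : nat) : X := iter i (fun z => z + y) x.

Definition delta (j : nat) (y : X) (rho : X -> Y) (x : X) : Y :=
  \sum_(i < j.+1) rho (add_times x y i) *~ ((-1) ^+ (j - i) * 'C(j, i)%:Z).

Definition monomial (j : nat) (rho : X -> Y) : Prop :=
  forall x y : X, delta j y rho x = rho y *+ j`!.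

End Monomials.

Definition fact_divisible (n : nat) (Y : zmodType) : Prop :=
  bijective (fun y : Y => y *+ n`!).

Record nonneg_half_line (R : realType) := NonnegHalfLine
  { nonneg_val :> R; nonneg_valP : 0 <= nonneg_val }.

HB.instance Definition _ (R : realType) :=
  [isSub for @nonneg_val R].
HB.instance Definition _ (R : realType) :=
  [Choice of nonneg_half_line R by <:].

Fact nonneg_addr_closed (R : realType) :
  addr_closed (fun t : R => 0 <= t).
Proof. by split=> [|x y]; [exact: lexx | exact: addr_ge0]. Qed.

HB.instance Definition _ (R : realType) :=
  GRing.SubChoice_isSubNmodule.Build R (fun t : R => 0 <= t)
    (nonneg_half_line R) (nonneg_addr_closed R).

Definition even_pow (R : realType) (m : nat) (even_m : ~~ odd m) (u : R) :
  nonneg_half_line R := NonnegHalfLine (exprn_even_ge0 u even_m).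

(* By [mrootP] and [mroot_unique] this is the real root wherever it exists;
   the default value 0 is only taken for even [m] and [t < 0] (or [m = 0]). *)
Definition mroot (R : realType) (m : nat) (t : R) : R :=
  xget 0 [set s : R | s ^+ m = t /\ (~~ odd m -> 0 <= s)]%classic.

Lemma mrootP (R : realType) (m : nat) (t : R) :
  (0 < m)%N -> (~~ odd m -> 0 <= t) ->
  mroot m t ^+ m = t /\ (~~ odd m -> 0 <= mroot m t).
Proof.
move=> m_gt0 tge0; rewrite /mroot.
pose P := [set s : R | s ^+ m = t /\ (~~ odd m -> 0 <= s)]%classic.
apply: (@xgetPex _ 0 P).
have rootK (a : R) : 0 <= a -> (a `^ m%:R^-1) ^+ m = a.
  move=> age0; rewrite -powR_mulrn ?powR_ge0// -powRrM mulVf ?powRr1//.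
  by rewrite pnatr_eq0 -lt0n.
have [tge|tlt] := leP 0 t.
  by exists (t `^ m%:R^-1); split; [exact: rootK | move=> _; exact: powR_ge0].
have oddm : odd m.
  by case: (boolP (odd m)) => // /tge0; rewrite leNgt tlt.
exists (- ((- t) `^ m%:R^-1)); split; last by rewrite oddm.
by rewrite exprNn rootK ?oppr_ge0 ?ltW// -signr_odd oddm expr1 mulN1r opprK.
Qed.

Lemma mroot_unique (R : realType) (m : nat) (s : R) :
  (0 < m)%N -> (~~ odd m -> 0 <= s) -> mroot m (s ^+ m) = s.
Proof.
move=> m_gt0 sge0.
have [|e r0] := @mrootP R m (s ^+ m) m_gt0.
  by move=> /sge0 ?; exact: exprn_ge0.
have [oddm|evenm] := boolP (odd m); last first.
  by apply/eqP; rewrite -(eqrXn2 m_gt0 (r0 evenm) (sge0 evenm)) e.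
move: (mroot m _) e {r0} => r e.
have pos_inj (a b : R) : 0 <= a -> 0 <= b -> a ^+ m = b ^+ m -> a = b.
  by move=> a0 b0 ab; apply/eqP; rewrite -(eqrXn2 m_gt0 a0 b0) ab.
have [r0|r0] := leP 0 r; have [s0|s0] := leP 0 s.
- exact: pos_inj.
- by move: (exprn_ge0 m r0); rewrite e exprn_odd_ge0// leNgt s0.
- by move: (exprn_ge0 m s0); rewrite -e exprn_odd_ge0// leNgt r0.
- apply: oppr_inj; apply: pos_inj; rewrite ?oppr_ge0 ?ltW//.
  by rewrite (exprNn r) (exprNn s) e.
Qed.

(* Main.v *)
Require Import Defs.
From mathcomp Require Import all_boot all_order all_algebra.
From mathcomp Require Import all_classical all_reals all_analysis.

Import Order.TTheory GRing.Theory Num.Theory.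
Local Open Scope ring_scope.

(** The equation only sees [u] and [v] through their powers, so it is the
    monomial equation for [f \o root] read along the power map, where [root] is
    a right inverse of that map: the power map covers all of [X].  The one
    thing to add is that [f] itself, not merely [f \o root], factors through the
    power map.  For even [m] this is the evenness of [f], and it comes from the
    right-hand side: the left-hand side depends on [v] only through its power,
    hence so does [n! f(v)], and multiplication by [n!] is injective on [Y].
    This argument is [delta_section_monomialP]; it serves both parities, since
    only the target [X] of the power map differs. *)

Lemma add_timesE (X : nmodType) (x y : X) (i : nat) :
  add_times x y i = x + y *+ i.
Proof.
by elim: i => [|i IH]; rewrite /add_times ?addr0 //= -/(add_times x y i) IH mulrSr addrA.
Qed.

Lemma eq_delta (X : addSemigroupType) (Y : zmodType) (j : nat) (y : X)
    (rho sigma : X -> Y) (x : X) :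
  rho =1 sigma -> delta j y rho x = delta j y sigma x.
Proof. by move=> eq_rho; apply: eq_bigr => i _; rewrite eq_rho. Qed.

(** Transfer of the monomial equation along a split surjection [p].  If the
    equation holds for [f], then [v] and [s (p v)] give the same left-hand
    side, so cancelling [n!] yields [f v = f (s (p v))], and [f \o s] is the
    required monomial. *)
Lemma delta_section_monomialP (U : Type) (X : addSemigroupType) (Y : zmodType)
    (n : nat) (p : U -> X) (s : X -> U) (f : U -> Y) :
  cancel s p -> injective (fun y : Y => y *+ n`!) ->
  (forall u v : U, delta n (p v) (f \o s) (p u) = f v *+ n`!) <->
  (exists rho : X -> Y, monomial n rho /\ forall u : U, f u = rho (p u)).
Proof.
move=> sK fact_inj; split=> [eq_f | [rho [rho_mono f_rho]] u v].
- exists (f \o s); split=> [x y | v]; first by rewrite -{1}(sK x) -{1}(sK y) eq_f.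
  by apply: fact_inj; rewrite /= -(eq_f v v) -(eq_f v) sK.
- rewrite f_rho -(rho_mono (p u)); apply: eq_delta => x /=.
  by rewrite f_rho sK.
Qed.

Theorem theorem3p1 (R : realType) (m n : nat) (Y : zmodType)
    (hm : (2 <= m)%N) (hn : (1 <= n)%N) (hY : fact_divisible n Y)
    (f : R -> Y) :
  let equation :=
    forall u v : R,
      \sum_(i < n.+1)
         f (mroot m (u ^+ m + v ^+ m *+ i))
           *~ ((-1) ^+ (n - i) * 'C(n, i)%:Z)
      = f v *+ n`! in
  (odd m ->
     (equation <->
      exists rho : R -> Y,
        monomial n rho /\ forall u : R, f u = rho (u ^+ m))) /\
  (forall even_m : ~~ odd m,
     (equation <->
      exists rho : nonneg_half_line R -> Y,
        monomial n rho /\ forall u : R, f u = rho (even_pow even_m u))).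
Proof.
have fact_inj := bij_inj hY; have m_gt0 : (0 < m)%N := ltnW hm.
move=> equation; split=> [odd_m | even_m].
- have rootK : cancel (mroot m) (fun u : R => u ^+ m).
    by move=> t; have [|] := @mrootP R m t m_gt0; rewrite ?odd_m.
  apply: iff_trans (delta_section_monomialP _ _ _ _ _ _ f rootK fact_inj).
  by split=> eq_f u v; rewrite -(eq_f u); apply: eq_bigr => i _ /=; rewrite add_timesE.
- pose root (t : nonneg_half_line R) : R := mroot m (nonneg_val t).
  have rootK : cancel root (even_pow even_m).
    move=> t; apply: val_inj => /=.
    by have [] := @mrootP R m (nonneg_val t) m_gt0 (fun _ => nonneg_valP t).
  have rootE (u v : R) i :
      root (add_times (even_pow even_m u) (even_pow even_m v) i)
      = mroot m (u ^+ m + v ^+ m *+ i).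
    rewrite -add_timesE /root; congr mroot.
    by elim: i => //= i ->.
  apply: iff_trans (delta_section_monomialP _ _ _ _ _ _ f rootK fact_inj).
  by split=> eq_f u v; rewrite -(eq_f u); apply: eq_bigr => i _ /=; rewrite rootE.
Qed.
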